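(* Let $X$ be a Banach space such that $C([0,1]^d)\subset X$ is continuously embedded in $X$, with embedding constant $c_0$ (that is, $\|f\|_X\le c_0\|f\|_{C([0,1]^d)}$ for all $f\in C([0,1]^d)$). Let $w(W)\ge 1$. Then the mapping $\Psi_\sigma:(B_{\ell_\infty^{\widetilde W}}(w(W)),\|\cdot\|_{\ell_\infty^{\widetilde W}})\to X$ is $L_W$-Lipschitz, that is, $$\|\Psi_\sigma(y)-\Psi_\sigma(y')\|_X\leq c_0\|\Psi_\sigma(y)-\Psi_\sigma(y')\|_{C([0,1]^d)}\leq L_W\|y-y'\|_{\ell_\infty^{\widetilde W}},\quad y,y'\in B_{\ell_\infty^{\widetilde W}}(w(W)),$$ with constant $$L_W=\begin{cases}C\,W\,w(W), & \sigma \text{ an } L\text{-Lipschitz sigmoidal function},\\ C\,W\,[w(W)]^2, & \sigma=\mathrm{ReLU},\end{cases}$$ where $C=C(d,L,c_0)$ depends only on $d,L,c_0$ (and not on $W$ or $w$).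
   Context: Shallow neural networks. Fix an input dimension $d\ge1$ and an activation function $\sigma:\mathbb R\to\mathbb R$ which is either $\mathrm{ReLU}(t)=\max\{0,t\}$ (then $L:=1$), or an $L$-Lipschitz sigmoidal function; the only properties of the latter that are used are $|\sigma(t)|\le 1$ and $|\sigma(t_1)-\sigma(t_2)|\le L|t_1-t_2|$ for all $t,t_1,t_2\in\mathbb R$. For a width $W\ge 2$ let $\bar\sigma:\mathbb R^W\to\mathbb R^W$ be $\sigma$ applied coordinatewise. For affine mappings $A^{(0)}:\mathbb R^d\to\mathbb R^W$ and $A^{(1)}:\mathbb R^W\to\mathbb R$, let $y\in\mathbb R^{\widetilde W}$ be the vector listing, in a fixed order, all entries of the matrices and offset vectors of $A^{(0)},A^{(1)}$, where $\widetilde W=W(d+1)+W+1$. Define on $[0,1]^d$ the function $\Psi_\sigma(y):=A^{(1)}\circ\bar\sigma\circ A^{(0)}$. For $r>0$, $B_{\ell_\infty^{m}}(r):=\{y\in\mathbb R^m:\max_j|y_j|\le r\}$. The function $w$ is a given bound on the parameters. *)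

(* Defs.v *)
From HB Require Import structures.
From mathcomp Require Import all_boot all_order all_algebra.
From mathcomp Require Import all_classical all_reals all_analysis.

Set Implicit Arguments.
Unset Strict Implicit.
Unset Printing Implicit Defensive.

Import Order.TTheory GRing.Theory Num.Theory.
Import numFieldNormedType.Exports.

Local Open Scope classical_set_scope.
Local Open Scope ring_scope.

Definition unit_cube (R : realType) (d : nat) : set 'rV[R]_d :=
  [set x | forall i, 0 <= x ord0 i <= 1].
Arguments unit_cube : clear implicits.

(* The cube as a topological space of its own (subtype topology), so that      *)
(* equality of functions on it does not involve values outside of the cube.   *)
Notation cube R d := (set_type (unit_cube R d)).

Definition continuous_pred (R : realType) (d : nat) : {pred cube R d -> R^o} :=
  mem [set f : cube R d -> R^o | continuous f].

Section continuous_pred_closed.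
Context (R : realType) (d : nat).

Lemma continuous_pred_submod : submod_closed (@continuous_pred R d).
Proof.
split=> [|a f g]; rewrite !inE /=.
  exact: (@cst_continuous _ R^o 0).
move=> cf cg x.
exact: (@cvgD R R^o _ _ _ _ _ _ _ (@cvgZl_tmp R R^o _ _ _ a _ _ (cf x)) (cg x)).
Qed.

HB.instance Definition _ :=
  GRing.isSubmodClosed.Build R (cube R d -> R^o) (@continuous_pred R d)
    continuous_pred_submod.

End continuous_pred_closed.

Record Ccube (R : realType) (d : nat) := CCube {
  Ccube_fun :> cube R d -> R^o;
  Ccube_subproof : Ccube_fun \in @continuous_pred R d
}.

Section Ccube_theory.
Context (R : realType) (d : nat).

HB.instance Definition _ := [isSub for @Ccube_fun R d].
HB.instance Definition _ := [Choice of Ccube R d by <:].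
HB.instance Definition _ := [SubChoice_isSubLmodule of Ccube R d by <:].

Implicit Types f g : Ccube R d.

Lemma Ccube_continuous f : continuous f.
Proof. by have := Ccube_subproof f; rewrite inE. Qed.

Lemma CcubeP f g : (forall x, f x = g x) -> f = g.
Proof. by move=> fg; apply/val_inj/funext. Qed.

Definition sup_norm f : R := sup [set `|f x| | x in [set: cube R d]].

Lemma unit_cube0 : unit_cube R d 0.
Proof. by move=> i; rewrite mxE lexx ler01. Qed.

Definition cube0 : cube R d := SigSub (mem_set unit_cube0).

Lemma unit_cube_compact : compact (unit_cube R d).
Proof.
have := @rV_compact R d (fun=> `[0 : R, 1]%classic)
  (fun=> @segment_compact R 0 1).
by congr compact; apply/seteqP; split=> x /= h i; have := h i; rewrite in_itv.
Qed.

Lemma sup_norm_has_sup f : has_sup [set `|f x| | x in [set: cube R d]].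
Proof.
split; first by exists `|f cube0|, cube0.
have cf : {within unit_cube R d, continuous (valL (f : cube R d -> R))}.
  exact/subspace_valL_continuousP/Ccube_continuous.
have cn : {within unit_cube R d, continuous (fun x => `|valL (f : _ -> R) x|)}.
  by move=> x; apply: cvg_norm; exact: cf.
have [] := EVT_max_rV _ unit_cube_compact cn; first by exists 0; exact: unit_cube0.
move=> c _ fc; exists `|valL (f : _ -> R) c| => _ [x _ <-].
have := fc _ (valP x).
by rewrite -[X in _ -> `|X| <= _](congr1 (fun h => h x) (valLK point (f : _ -> R))).
Qed.

Lemma sup_norm_ub f x : `|f x| <= sup_norm f.
Proof. by apply: (sup_upper_bound (sup_norm_has_sup f)); exists x. Qed.

Lemma sup_norm_le f M : (forall x, `|f x| <= M) -> sup_norm f <= M.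
Proof.
move=> fM; apply: ge_sup; first by exists `|f cube0|, cube0.
by move=> _ [x _ <-].
Qed.

Lemma sup_norm_triangle f g : sup_norm (f + g) <= sup_norm f + sup_norm g.
Proof.
apply: sup_norm_le => x; apply: (le_trans (ler_normD _ _)).
by apply: lerD; exact: sup_norm_ub.
Qed.

Lemma sup_normZ (a : R) f : sup_norm (a *: f) = `|a| * sup_norm f.
Proof.
have le b g : sup_norm (b *: g) <= `|b| * sup_norm g.
  apply: sup_norm_le => x.
  by rewrite [X in `|X|](_ : _ = b * g x)// normrM ler_wpM2l// sup_norm_ub.
apply/eqP; rewrite eq_le le /=; have [->|a0] := eqVneq a 0.
  by rewrite normr0 mul0r (le_trans _ (sup_norm_ub _ cube0)).
rewrite -ler_pdivlMl ?normr_gt0// -normfV.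
by apply: le_trans (le _ _); rewrite scalerA mulVf// scale1r.
Qed.

Lemma sup_norm0_eq0 f : sup_norm f = 0 -> f = 0.
Proof.
move=> f0; apply: CcubeP => x; apply/eqP.
by rewrite -normr_le0 -f0 sup_norm_ub.
Qed.

HB.instance Definition _ := Lmodule_isNormed.Build R (Ccube R d)
  sup_norm_triangle sup_normZ sup_norm0_eq0.

Lemma Ccube_normE f : `|f| = sup [set `|f x| | x in [set: cube R d]].
Proof. by []. Qed.

End Ccube_theory.

Variant activation_kind := Sigmoidal | ReLU.

(* Of a sigmoidal function only the bound and the Lipschitz property are      *)
(* required; no limits at infinity or monotonicity are imposed.               *)
Definition is_activation (R : realType) (k : activation_kind) (L : R)
    (sigma : R -> R) : Prop :=
  match k with
  | Sigmoidal => (forall t, `|sigma t| <= 1) /\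
      (forall t1 t2, `|sigma t1 - sigma t2| <= L * `|t1 - t2|)
  | ReLU => L = 1 /\ sigma = (fun t => Num.max 0 t)
  end.

Lemma activation_lipschitz (R : realType) k (L : R) (sigma : R -> R) :
  is_activation k L sigma ->
  forall t1 t2, `|sigma t1 - sigma t2| <= L * `|t1 - t2|.
Proof.
case: k => [[_ //]|[-> ->]] t1 t2; rewrite mul1r.
wlog le12 : t1 t2 / t1 <= t2 => [wl|].
  have [/wl//|/ltW/wl] := leP t1 t2.
  by rewrite distrC [X in _ <= X]distrC.
rewrite distrC [X in _ <= X]distrC [X in _ <= X]ger0_norm ?subr_ge0//.
case: (leP 0 t1) => h1; case: (leP 0 t2) => h2.
- by rewrite ger0_norm ?subr_ge0.
- by have := lt_le_trans h2 (le_trans h1 le12); rewrite ltxx.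
- by rewrite subr0 ger0_norm// lerDl oppr_ge0 ltW.
- by rewrite subrr normr0 subr_ge0.
Qed.

Lemma activation_continuous (R : realType) k (L : R) (sigma : R -> R) :
  is_activation k L sigma -> continuous sigma.
Proof.
move=> /activation_lipschitz hL x; apply/cvgrPdist_le => e e0.
have M0 : 0 < `|L| + 1 by rewrite ltr_wpDl.
near=> t; apply: le_trans (hL _ _) _.
apply: (@le_trans _ _ ((`|L| + 1) * `|x - t|)).
  by rewrite ler_wpM2r// (le_trans (ler_norm _))// lerDl.
rewrite -ler_pdivlMl// mulrC; near: t.
by apply: cvgr_dist_le => //; rewrite divr_gt0.
Unshelve. all: by end_near. Qed.

(* Points are row vectors; the library norm of 'rV is the l_infinity norm.    *)

Definition nb_params (d W : nat) : nat := (W * (d + 1) + W + 1)%N.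

Section network.
Context (R : realType) (d W : nat).
Implicit Type y : 'rV[R]_(nb_params d W).

(* Order of the parameters: the rows of the W x (d + 1) matrix [weights |     *)
(* offset] of A0 one after the other, then the W weights of A1, then the      *)
(* offset of A1.                                                              *)
Definition hidden_mx y : 'M[R]_(W, d + 1) := vec_mx (lsubmx (lsubmx y)).

Definition affine0 y (x : 'rV[R]_d) : 'rV[R]_W :=
  x *m (lsubmx (hidden_mx y))^T + (rsubmx (hidden_mx y))^T.

Definition affine1 y (z : 'rV[R]_W) : R :=
  (z *m (rsubmx (lsubmx y))^T) ord0 ord0 + rsubmx y ord0 ord0.

Definition network (sigma : R -> R) y (x : 'rV[R]_d) : R :=
  affine1 y (map_mx sigma (affine0 y x)).

Lemma affine_comb_continuous (T : topologicalType) n (F : 'I_n -> T -> R)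
    (a : 'I_n -> R) (b : R) : (forall i, continuous (F i)) ->
  continuous (fun x => \sum_i F i x * a i + b).
Proof.
move=> cF; have cS : continuous (fun x => \sum_i F i x * a i : R^o).
  apply: (@continuous_big R^o) => [|i _ x]; first exact: (@add_continuous R^o).
  by apply: (@cvgM R); [exact: cF|exact: cvg_cst].
by move=> x; apply: (@cvgD R R^o); [exact: cS|exact: cvg_cst].
Qed.

Lemma network_continuous (sigma : R -> R) y :
  continuous sigma -> continuous (network sigma y).
Proof.
move=> cs.
have -> : network sigma y = fun x => \sum_j sigma (affine0 y x ord0 j) *
    (rsubmx (lsubmx y))^T j ord0 + rsubmx y ord0 ord0.
  apply/funext => x; rewrite /network /affine1 mxE; congr (_ + _).
  by apply: eq_bigr => j _; rewrite mxE.
apply: affine_comb_continuous => j x.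
apply: (@continuous_comp _ _ _ (fun x => affine0 y x ord0 j)); last exact: cs.
have -> : (fun x => affine0 y x ord0 j) = fun x : 'rV[R]_d =>
    \sum_i x ord0 i * (lsubmx (hidden_mx y))^T i j + (rsubmx (hidden_mx y))^T ord0 j.
  by apply/funext => x0; rewrite /affine0 !mxE.
by apply: affine_comb_continuous => i; exact: coord_continuous.
Qed.

Lemma network_in_continuous_pred (sigma : R -> R) y : continuous sigma ->
  (fun x : cube R d => network sigma y (val x) : R^o) \in @continuous_pred R d.
Proof.
move=> cs; rewrite inE /= => x.
apply: (@continuous_comp _ _ _ (set_val : cube R d -> 'rV[R]_d)
  (network sigma y)); first exact: initial_continuous.
exact: network_continuous.
Qed.

(* The proof argument only serves to make Psi land in C([0,1]^d).             *)
Definition Psi (sigma : R -> R) (cs : continuous sigma) y : Ccube R d :=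
  CCube (network_in_continuous_pred y cs).

End network.

Definition lip_const (R : realType) (k : activation_kind) (C : R)
    (W : nat) (wW : R) : R :=
  match k with
  | Sigmoidal => C * W%:R * wW
  | ReLU => C * W%:R * wW ^+ 2
  end.

(* Main.v *)
(** A parameter entry moves by at most [`|y - y'|]. On the cube the map
    [y |-> affine0 y x] is linear and each of its coordinates is a sum of [d + 1]
    terms bounded by the norm of [y]; hence the hidden pre-activations differ
    by at most [(d + 1) `|y - y'|]. Writing [s a - s' a' = (s - s') a + s' (a - a')]
    for each of the [W] hidden units, the two activations enter only through a
    bound on [s']: it is [1] in the sigmoidal case and [(d + 1) w] for ReLU,
    which accounts for the additional factor [w]. *)

Require Import Defs.
From mathcomp Require Import all_boot all_order all_algebra.
From mathcomp Require Import all_classical all_reals all_analysis.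
From mathcomp Require Import lra.

Import Order.TTheory GRing.Theory Num.Theory.
Import numFieldNormedType.Exports.

Local Open Scope classical_set_scope.
Local Open Scope ring_scope.

Section network_bounds.
Context {R : realType} {d W : nat}.
Implicit Types (y : 'rV[R]_(nb_params d W)) (x : 'rV[R]_d) (sigma : R -> R).

Lemma normr_rV_entry n (u : 'rV[R]_n) i : `|u ord0 i| <= `|u|.
Proof.
rewrite [leRHS]mx_normrE; exact: (le_bigmax _ (fun ij => `|u ij.1 ij.2|) (ord0, i)).
Qed.

Lemma affine0B y y' x : affine0 y x - affine0 y' x = affine0 (y - y') x.
Proof. by rewrite /affine0 /hidden_mx !linearB /= addrACA opprD. Qed.

Lemma affine0_entry_le y x j : unit_cube R d x ->
  `|affine0 y x ord0 j| <= (d%:R + 1) * `|y|.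
Proof.
move=> xP; rewrite !mxE mulrDl mul1r; apply: (le_trans (ler_normD _ _)).
apply: lerD; last exact: normr_rV_entry.
apply: (le_trans (ler_norm_sum _ _ _)).
(* The factor [d] is unfolded into a sum of equal terms, so that the comparison can be made input by
   input. *)
rewrite mulr_natl -[X in _ *+ X]card_ord -sumr_const; apply: ler_sum => i _.
have /andP[x0 x1] := xP i.
rewrite normrM (ger0_norm x0) -[leRHS]mul1r; apply: ler_pM => //.
by rewrite !mxE; exact: normr_rV_entry.
Qed.

Lemma networkE sigma y x : network sigma y x =
  \sum_j sigma (affine0 y x ord0 j) * rsubmx (lsubmx y) ord0 j
    + rsubmx y ord0 ord0.
Proof.
rewrite /network /affine1 mxE; congr (_ + _); apply: eq_bigr => j _.
by rewrite [X in X * _]mxE [X in _ * X]mxE.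
Qed.

(** The roles of [y] and [y'] are asymmetric: [w] serves to bound the outer weights of [y], [M] the
    activations of [y']. An abstract [M] lets one estimate serve both kinds of activation; the final
    [+ 1] pays for the outer offset. *)
Lemma network_dist sigma (L w M : R) y y' x :
  0 <= L -> (forall t1 t2, `|sigma t1 - sigma t2| <= L * `|t1 - t2|) ->
  unit_cube R d x -> `|y| <= w ->
  (forall j, `|sigma (affine0 y' x ord0 j)| <= M) ->
  `|network sigma y x - network sigma y' x| <=
    (W%:R * (L * (d%:R + 1) * w + M) + 1) * `|y - y'|.
Proof.
move=> L0 sL xP yw sM; rewrite !networkE opprD addrACA mulrDl mul1r.
apply: (le_trans (ler_normD _ _)); apply: lerD; last first.
  rewrite (_ : _ - _ = (y - y') ord0 (rshift _ ord0)); last by rewrite !mxE.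
  exact: normr_rV_entry.
rewrite -sumrB; apply: (le_trans (ler_norm_sum _ _ _)).
rewrite -mulrA mulr_natl -[X in _ *+ X]card_ord -sumr_const.
apply: ler_sum => j _.
set s := sigma _; set s' := sigma (affine0 y' _ _ _).
set a := rsubmx _ _ _; set a' := rsubmx (lsubmx y') _ _.
have -> : s * a - s' * a' = (s - s') * a + s' * (a - a').
  by rewrite mulrBl mulrBr addrA subrK.
rewrite [leRHS]mulrDl; apply: (le_trans (ler_normD _ _)); rewrite !normrM.
apply: lerD; last first.
  apply: ler_pM => //; first exact: sM.
  rewrite (_ : a - a' = (y - y') ord0 (lshift 1 (rshift _ j))).
    exact: normr_rV_entry.
  by rewrite /a /a' !mxE.
rewrite mulrAC; apply: ler_pM => //; last first.
  by rewrite /a !mxE; exact: le_trans (normr_rV_entry _ _ _) yw.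
apply: (le_trans (sL _ _)); rewrite -mulrA; apply: ler_wpM2l => //.
by have := affine0_entry_le (y - y') _ j xP; rewrite -affine0B mxE [X in _ + X]mxE.
Qed.

End network_bounds.

Lemma ReLU_norm_le {R : realType} (t : R) : `|Num.max 0 t| <= `|t|.
Proof. by rewrite ger0_norm ?le_max ?lexx// ge_max normr_ge0 ler_norm. Qed.

Theorem theorem3p3 (R : realType) (d : nat) (hd : (1 <= d)%N) (L c0 : R) :
  exists C : R,
    forall (X : completeNormedModType R) (iota : {linear Ccube R d -> X})
      (iota_inj : injective iota)
      (iota_bounded : forall f : Ccube R d, `|iota f| <= c0 * `|f|)
      (k : activation_kind) (sigma : R -> R)
      (sigmaP : is_activation k L sigma)
      (w : nat -> R) (W : nat) (hW : (2 <= W)%N) (hw : 1 <= w W)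
      (y y' : 'rV[R]_(nb_params d W)),
    `|y| <= w W -> `|y'| <= w W ->
    let psi := @Psi R d W sigma (activation_continuous sigmaP) in
    `|iota (psi y) - iota (psi y')| <= c0 * `|psi y - psi y'| /\
    c0 * `|psi y - psi y'| <= lip_const k C W (w W) * `|y - y'|.
Proof.
(* [C] is chosen before any activation or embedding is given, so the signs of [L] and [c0] are
   unknown: hence the absolute values. The inner [+ 1] covers [M], the outer one the offset of the
   last layer. *)
exists (`|c0| * ((`|L| + 1) * (d%:R + 1) + 1)).
move=> X iota _ iota_bounded k sigma sigmaP w W hW hw y y' yw y'w psi.
split; first by rewrite -linearB; exact: iota_bounded.
set v := w W in hw yw y'w *; set D : R := d%:R + 1.
have sL t1 t2 : `|sigma t1 - sigma t2| <= `|L| * `|t1 - t2|.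
  apply: le_trans (activation_lipschitz sigmaP t1 t2) _.
  by rewrite ler_wpM2r// ler_norm.
have D1 : 1 <= D by rewrite lerDr.
have W1 : 1 <= W%:R :> R by rewrite ler1n ltnW.
have L0 := normr_ge0 L; have v0 : 0 <= v := le_trans ler01 hw.
have W0 : 0 <= W%:R :> R by [].
have D0 : 0 <= D := le_trans ler01 D1.
have Wv1 : 1 <= W%:R * v by rewrite -[leLHS]mulr1 ler_pM.
have Dv1 : 1 <= D * v by rewrite -[leLHS]mulr1 ler_pM.
(* After expansion the two sides differ by exactly [W%:R * v - 1], which [Wv1] makes nonnegative. *)
have lip_le : W%:R * (`|L| * D * v + D * v) + 1 <=
    ((`|L| + 1) * D + 1) * W%:R * v by nra.
have [M sM MB] : exists2 M, (forall (x : cube R d) j,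
      `|sigma (affine0 y' (val x) ord0 j)| <= M) &
    W%:R * (`|L| * D * v + M) + 1 <= lip_const k ((`|L| + 1) * D + 1) W v.
  move: sigmaP {psi}; case: k => [[sb _]|[_ sE]].
    exists 1 => [x j|/=]; first exact: sb.
    (* [M = 1] is dominated by [D * v], thanks to [Dv1]. *)
    by apply: le_trans lip_le; rewrite lerD2r ler_wpM2l// lerD2l.
  exists (D * v) => [x j|/=].
    rewrite sE; apply: (le_trans (ReLU_norm_le _)).
    apply: (le_trans (affine0_entry_le y' _ j _)); first exact: set_mem (valP x).
    by rewrite ler_wpM2l.
  (* [lip_le] gives a bound linear in [v]; since [1 <= v], it is at most the quadratic one. *)
  apply: (le_trans lip_le); rewrite expr2 mulrA ler_peMr//.
  by rewrite !mulr_ge0// addr_ge0// mulr_ge0// addr_ge0.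
have -> : lip_const k (`|c0| * ((`|L| + 1) * D + 1)) W v =
    `|c0| * lip_const k ((`|L| + 1) * D + 1) W v.
  by case: (k) => /=; rewrite !mulrA.
apply: (@le_trans _ _ (`|c0| * `|psi y - psi y'|)).
  by rewrite ler_wpM2r// ler_norm.
(* The norm of [Ccube] is the supremum over the cube, so a pointwise bound suffices. *)
rewrite -mulrA ler_wpM2l//; apply: sup_norm_le => x.
apply: (@le_trans _ _ ((W%:R * (`|L| * D * v + M) + 1) * `|y - y'|)).
  by apply: (network_dist sigma) => //; exact: set_mem (valP x).
by rewrite ler_wpM2r.
Qed.
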